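(* Let $(\eta_k)_{k\ge0}$ and $(\theta_l)_{l\ge0}$ be sequences of pairwise distinct complex numbers with intertwining sequence $(H_j)_{j\ge1}$. For all $N\ge1$, the set $\Omega_N=\{H_1,\ldots,H_N\}$ is unisolvent for the space $\mathcal{P}_{n,m}$ associated with $N$: for every function $f:\Omega_N\to\mathbb{C}$ there exists a unique polynomial $P\in\mathcal{P}_{n,m}$ such that $P(z,w)=f(z,w)$ for every $(z,w)\in\Omega_N$. In addition, $P$ is the Lagrange polynomial $$L^{(N)}[f]=\sum_{k=1}^Nf(H_k)\,l^{(N)}_{H_k},$$ where the $l^{(N)}_{H_k}$ are the polynomials given by explicit formulas in the context.
   Context: Order $\mathbb{N}^2$ ($0\in\mathbb{N}$) by $(k_1,l_1)\le(k_2,l_2)$ iff $k_1+l_1<k_2+l_2$, or $k_1+l_1=k_2+l_2$ and $k_1\ge k_2$; this enumerates $\mathbb{N}^2$ as $(k(1),l(1)),(k(2),l(2)),\ldots=(0,0),(1,0),(0,1),(2,0),(1,1),\ldots$. Put $e_j(z,w)=z^{k(j)}w^{l(j)}$. The intertwining sequence of $(\eta_k)_{k\ge0}$ and $(\theta_l)_{l\ge0}$ is $H_j=(\eta_{k(j)},\theta_{l(j)})$, $j\ge1$. Let $N_n=\frac{(n+1)(n+2)}2$ for $n\ge-1$ (so $N_{-1}=0$). For $N\ge1$, the associated integers $n\ge0$ and $0\le m\le n$ are defined by $N_{n-1}<N\le N_n$ and $m=N-N_{n-1}-1$, and $\mathcal{P}_{n,m}=\mathrm{span}\{e_j:1\le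 j\le N\}$ (dimension $N$). Explicit formulas. If $H_k=(\eta_p,\theta_q)\in\Omega_N$, write $E_p^a=\prod_{0\le j\le a,\,j\ne p}\frac{z-\eta_j}{\eta_p-\eta_j}$ and $F_q^b=\prod_{0\le i\le b,\,i\ne q}\frac{w-\theta_i}{\theta_q-\theta_i}$ (empty products $1$, empty sums $0$). Then $l^{(N)}_{H_k}(z,w)$ is defined as: (1) $E_p^{p-1}F_q^{q-1}$ if $p+q=n$, or $p+q=n-1$ and $q\ge m+1$; (2) $E_{n-m-1}^{n-m}F_m^{m-1}$ if $p+q=n-1$, $q=m$; (3) $E_p^{p+1}F_q^{q-1}-E_p^{p-1}F_q^{q-1}+E_p^{p-1}F_q^{q+1}$ if $p+q=n-1$, $q\le m-1$; (4) $E_p^{n-q}F_q^{q-1}-E_p^{n-q-1}F_q^{q-1}+E_p^{n-q-1}F_q^{q+1}+\sum_{r=1}^{m-q-1}[E_p^{n-q-r-1}F_q^{q+r+1}-E_p^{n-q-r-1}F_q^{q+r}]+\sum_{r=m-q}^{n-p-q-2}[E_p^{n-q-r-2}F_q^{q+r+1}-E_p^{n-q-r-2}F_q^{q+r}]$ if $p+q\le n-2$, $q\le m-1$, $p\le n-m-1$; (5) $E_p^{n-q}F_q^{q-1}-E_p^{n-q-1}F_q^{q-1}+E_p^{n-q-1}F_q^{q+1}+\sum_{r=1}^{n-p-q-1}[E_p^{n-q-r-1}F_q^{q+r+1}-E_p^{n-q-r-1}F_q^{q+r}]$ if $p+q\le n-2$, $q\le m-1$, $p\ge n-m$; (6) $E_p^{n-m}F_m^{m-1}-E_p^{n-m-2}F_m^{m-1}+E_p^{n-m-2}F_m^{m+1}+\sum_{r=1}^{n-m-p-2}[E_p^{n-m-r-2}F_m^{m+r+1}-E_p^{n-m-r-2}F_m^{m+r}]$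 if $p+q\le n-2$, $q=m$; (7) $E_p^{n-q-1}F_q^{q-1}-E_p^{n-q-2}F_q^{q-1}+E_p^{n-q-2}F_q^{q+1}+\sum_{r=1}^{n-p-q-2}[E_p^{n-q-r-2}F_q^{q+r+1}-E_p^{n-q-r-2}F_q^{q+r}]$ if $p+q\le n-2$, $q\ge m+1$. *)

(* Defs.v *)
From HB Require Import structures.
From mathcomp Require Import all_boot all_order all_algebra.
From mathcomp Require Import reals complex mpoly.

Set Implicit Arguments.
Unset Strict Implicit.
Unset Printing Implicit Defensive.

Import Order.TTheory GRing.Theory Num.Theory.
Local Open Scope ring_scope.

Definition deglex_le (a b : nat * nat) : bool :=
  (a.1 + a.2 < b.1 + b.2)%N || ((a.1 + a.2 == b.1 + b.2)%N && (b.1 <= a.1)%N).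

Definition next_index (a : nat * nat) : nat * nat :=
  if a.1 is k.+1 then (k, a.2.+1) else (a.2.+1, 0%N).

(* [index_pair j] is (k(j), l(j)) for j >= 1; its value at j = 0 is junk.
   The lemmas [index_pair_mono] and [index_pair_surj] say that it is the
   enumeration of N^2 determined by [deglex_le]. *)
Definition index_pair (j : nat) : nat * nat := iter j.-1 next_index (0%N, 0%N).

Lemma deglex_le_trans : transitive deglex_le.
Proof.
move=> [b1 b2] [a1 a2] [c1 c2]; rewrite /deglex_le /=.
case/orP=> [ab|/andP[/eqP ab ab1]] /orP[bc|/andP[/eqP bc bc1]].
- by rewrite (ltn_trans ab bc).
- by rewrite -bc ab.
- by rewrite ab bc.
- by rewrite ab bc eqxx (leq_trans bc1 ab1) orbT.
Qed.

Lemma next_index_nle a : ~~ deglex_le (next_index a) a.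
Proof.
case: a => [[|k] l]; rewrite /deglex_le /next_index /=.
  by rewrite addn0 add0n ltnNge leqnSn /= eqn_leq ltnn.
by rewrite addnS -addSn ltnn eqxx /= ltnn.
Qed.

Lemma next_index_ge a : deglex_le a (next_index a).
Proof.
case: a => [[|k] l]; rewrite /deglex_le /next_index /=.
  by rewrite addn0 add0n ltnSn.
by rewrite addnS -addSn ltnn eqxx /= leqnSn.
Qed.

Lemma index_pair_mono i j :
  (0 < i)%N -> (0 < j)%N ->
  deglex_le (index_pair i) (index_pair j) = (i <= j)%N.
Proof.
case: i j => [//|i] [//|j] _ _; rewrite /index_pair /= ltnS.
have le d k : deglex_le (iter k next_index (0, 0)%N)
                        (iter (d + k) next_index (0, 0)%N).
  elim: d => [|d IH]; first by rewrite /deglex_le eqxx leqnn orbT.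
  exact: deglex_le_trans IH (next_index_ge _).
case: leqP => [ij|ji]; first by rewrite -(subnK ij) le.
apply/negbTE/negP => ij.
have := le (i - j.+1)%N j.+1; rewrite subnK // => ji'.
by have := deglex_le_trans ji' ij; rewrite iterS (negbTE (next_index_nle _)).
Qed.

Lemma index_pair_surj a : exists2 j, (0 < j)%N & index_pair j = a.
Proof.
suff H : exists j, iter j next_index (0, 0)%N = a.
  by case: H => j <-; exists j.+1.
case: a => k l; move Es: (k + l)%N => s.
elim: s k l Es => [|s IHs] k l Es.
  by exists 0%N; move/eqP: Es; rewrite addn_eq0 => /andP[/eqP-> /eqP->].
elim: l k Es => [|l IHl] k Es.
  have [j Ej] := IHs 0%N s (add0n s).
  by exists j.+1; rewrite iterS Ej; rewrite addn0 in Es; rewrite Es.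
have [|j Ej] := IHl k.+1; first by rewrite addSnnS.
by exists j.+1; rewrite iterS Ej.
Qed.

(* N_n = (n+1)(n+2)/2 is [n.+1 * n.+2 ./2]; N_{n-1} is [n * n.+1 ./2], which is
   also right for n = 0, where N_{-1} = 0. *)
Definition associated (N n m : nat) : Prop :=
  ((n * n.+1)./2 < N <= (n.+1 * n.+2)./2)%N /\ m = (N - (n * n.+1)./2 - 1)%N.

Lemma associated_exists N : (0 < N)%N -> exists n m, associated N n m.
Proof.
move=> N0; have ex : exists n, (N <= (n.+1 * n.+2)./2)%N.
  exists N; rewrite -[X in (X <= _)%N](doubleK N) half_leq //.
  by rewrite -muln2 leq_mul.
case: (ex_minnP ex) => n Nn min_n.
exists n, (N - (n * n.+1)./2 - 1)%N; split=> //; rewrite Nn andbT.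
case: n Nn min_n => [|n] _ min_n //=.
by rewrite ltnNge; apply/negP => /min_n; rewrite ltnn.
Qed.

Section Interpolation.

Variable C : fieldType.
Implicit Types (eta theta : nat -> C) (P : {mpoly C[2]}) (f : C * C -> C).

Definition varZ : {mpoly C[2]} := 'X_ord0.
Definition varW : {mpoly C[2]} := 'X_ord_max.

Definition evalp P (x : C * C) : C :=
  P.@[fun i : 'I_2 => if i == ord0 then x.1 else x.2].

Definition monom (j : nat) : {mpoly C[2]} :=
  varZ ^+ (index_pair j).1 * varW ^+ (index_pair j).2.

Definition inPspace (N : nat) P : Prop :=
  exists c : nat -> C, P = \sum_(1 <= j < N.+1) c j *: monom j.

Definition intertwining eta theta (j : nat) : C * C :=
  (eta (index_pair j).1, theta (index_pair j).2).

Definition Omega eta theta (N : nat) : seq (C * C) :=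
  [seq intertwining eta theta j | j <- iota 1 N].

Definition interpolates (A : seq (C * C)) f P : Prop :=
  forall x, x \in A -> evalp P x = f x.

(* A function on the finite set A is given by a function on C * C, of which
   only the values on A matter. *)
Definition unisolvent (A : seq (C * C)) (V : {mpoly C[2]} -> Prop) : Prop :=
  forall f, exists! P, V P /\ interpolates A f P.

(* In [Efac eta p a] = E_p^a and [Ffac theta q b] = F_q^b the bounds are natural
   numbers.  The only negative bound that occurs in the formulas is p - 1 for
   p = 0 (and q - 1 for q = 0); truncated subtraction turns it into 0, and
   E_0^0 is the empty product, as E_0^{-1} is, because the index p is
   skipped. *)
Definition Efac eta (p a : nat) : {mpoly C[2]} :=
  \prod_(0 <= j < a.+1 | j != p)
    ((eta p - eta j)^-1 *: (varZ - (eta j)%:MP)).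

Definition Ffac theta (q b : nat) : {mpoly C[2]} :=
  \prod_(0 <= i < b.+1 | i != q)
    ((theta q - theta i)^-1 *: (varW - (theta i)%:MP)).

(* The polynomial l^{(N)} at the point (eta_p, theta_q), for the n and m
   associated with N.  In the conditions, [p + q = n - 1] is written
   [p + q + 1 == n], [q <= m - 1] is [q < m], etc., so that they have their
   meaning in the integers.  The seven cases are disjoint and cover all
   (p, q) that index a point of Omega_N. *)
Definition lagrange_basis eta theta (n m p q : nat) : {mpoly C[2]} :=
  let E := Efac eta in
  let F := Ffac theta in
  if ((p + q == n) || (p + q + 1 == n) && (m + 1 <= q))%N then
    E p (p - 1)%N * F q (q - 1)%N
  else if ((p + q + 1 == n) && (q == m))%N then
    E (n - m - 1)%N (n - m)%N * F m (m - 1)%N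
  else if ((p + q + 1 == n) && (q < m))%N then
    E p (p + 1)%N * F q (q - 1)%N - E p (p - 1)%N * F q (q - 1)%N
    + E p (p - 1)%N * F q (q + 1)%N
  else if [&& p + q + 2 <= n, q < m & p + m + 1 <= n]%N then
    E p (n - q)%N * F q (q - 1)%N - E p (n - q - 1)%N * F q (q - 1)%N
    + E p (n - q - 1)%N * F q (q + 1)%N
    + \sum_(1 <= r < m - q)
        (E p (n - q - r - 1)%N * F q (q + r + 1)%N
         - E p (n - q - r - 1)%N * F q (q + r)%N)
    + \sum_(m - q <= r < n - p - q - 1)
        (E p (n - q - r - 2)%N * F q (q + r + 1)%N
         - E p (n - q - r - 2)%N * F q (q + r)%N)
  else if [&& p + q + 2 <= n, q < m & n <= p + m]%N then
    E p (n - q)%N * F q (q - 1)%N - E p (n - q - 1)%N * F q (q - 1)%N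
    + E p (n - q - 1)%N * F q (q + 1)%N
    + \sum_(1 <= r < n - p - q)
        (E p (n - q - r - 1)%N * F q (q + r + 1)%N
         - E p (n - q - r - 1)%N * F q (q + r)%N)
  else if ((p + q + 2 <= n) && (q == m))%N then
    E p (n - m)%N * F m (m - 1)%N - E p (n - m - 2)%N * F m (m - 1)%N
    + E p (n - m - 2)%N * F m (m + 1)%N
    + \sum_(1 <= r < n - m - p - 1)
        (E p (n - m - r - 2)%N * F m (m + r + 1)%N
         - E p (n - m - r - 2)%N * F m (m + r)%N)
  else if ((p + q + 2 <= n) && (m + 1 <= q))%N then
    E p (n - q - 1)%N * F q (q - 1)%N - E p (n - q - 2)%N * F q (q - 1)%N
    + E p (n - q - 2)%N * F q (q + 1)%N
    + \sum_(1 <= r < n - p - q - 1)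
        (E p (n - q - r - 2)%N * F q (q + r + 1)%N
         - E p (n - q - r - 2)%N * F q (q + r)%N)
  else 0.

Definition lagrange_poly eta theta (N n m : nat) f : {mpoly C[2]} :=
  \sum_(1 <= k < N.+1)
    f (intertwining eta theta k) *:
      lagrange_basis eta theta n m (index_pair k).1 (index_pair k).2.

End Interpolation.

(* Main.v *)
(* The index set of Omega_N is a staircase: row b is {0, ..., a_b} with a_b
   nonincreasing in b.  Telescoping along the rows, the cases of the explicit
   formula all read
     l_(p,q) = E_p^(a_q) F_q^q
               + sum_(q <= b < B) E_p^(a_(b+1)) (F_q^(b+1) - F_q^b),
   where B is the last row that contains p.  At (eta_s, theta_t) with s <> p,
   the E-factors kill the rows b <= t and the differences of F kill the rows
   b > t; with s = p, the sum telescopes to F_q^B(theta_t), which is 1 if t = q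
   and 0 otherwise.  Since every term lies in the span of the monomials of the
   staircase, the square matrix of values of the monomials has a one-sided
   inverse, hence an inverse, which gives uniqueness. *)
Require Import Defs.
From mathcomp Require Import all_boot all_order all_algebra.
From mathcomp Require Import reals complex mpoly.
From mathcomp Require Import zify.

Set Implicit Arguments.
Unset Strict Implicit.
Unset Printing Implicit Defensive.

Import GRing.Theory.
Local Open Scope ring_scope.

(** * Rows and columns of the staircase *)

Definition staircase (n m p q : nat) : bool :=
  (p + q < n)%N || ((p + q == n)%N && (q <= m)%N).

(* Last index of row b; junk (0) if row b is empty. *)
Definition row_last (n m b : nat) : nat :=
  if (b <= m)%N then (n - b)%N else (n - 1 - b)%N.

(* Last row containing p; junk (0) if there is none. *)
Definition col_last (n m p : nat) : nat :=
  if (n <= p + m)%N then (n - p)%N else (n - 1 - p)%N.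

Lemma staircase_col n m p q :
  staircase n m p q -> (q <= col_last n m p)%N.
Proof. by rewrite /staircase /col_last; case: ifP; lia. Qed.

Lemma staircase_row n m p q :
  staircase n m p q -> (p <= row_last n m q)%N.
Proof. by rewrite /staircase /row_last; case: ifP; lia. Qed.

(** Empty rows are no exception: truncated subtraction gives them the value 0, and they come after
    all nonempty rows. *)
Lemma row_last_anti n m b c :
  (b <= c)%N -> (row_last n m c <= row_last n m b)%N.
Proof. by rewrite /row_last; do 2!case: ifP; lia. Qed.

Lemma staircase_col_last n m p q b :
  staircase n m p q -> (b <= col_last n m p)%N -> staircase n m p b.
Proof. by rewrite /staircase /col_last; case: ifP; lia. Qed.

(** Rows shrink as their index grows, so a nonempty row b carries a full rectangle below it. This
    rectangle will hold the exponents of a product of an E and an F. *)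
Lemma staircase_row_last n m p b i j :
  staircase n m p b -> (i <= row_last n m b)%N -> (j <= b)%N ->
  staircase n m i j.
Proof. by rewrite /staircase /row_last; case: ifP; lia. Qed.

(** * Positions in the enumeration *)

Lemma half_triangleS n : ((n.+1 * n.+2)./2 = (n * n.+1)./2 + n.+1)%N.
Proof.
have -> : (n.+1 * n.+2 = n * n.+1 + n.+1.*2)%N by lia.
by rewrite halfD doubleK odd_double andbF add0n.
Qed.

(** Within an antidiagonal, [next_index] raises the second coordinate by one; from its end (0, n) it
    jumps to (n + 1, 0), which starts the next triangular block. *)
Lemma index_pair_triangle n m :
  (m <= n)%N -> index_pair ((n * n.+1)./2 + m).+1 = ((n - m)%N, m).
Proof.
rewrite /index_pair /=.
elim: n m => [|n IHn] m; first by rewrite leqn0 => /eqP ->.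
elim: m => [_|m IHm mn].
  have := IHn n (leqnn n).
  by rewrite half_triangleS addn0 addnS iterS => ->; rewrite subnn subn0.
rewrite addnS iterS IHm; last exact: ltnW.
by rewrite subSn // subSS.
Qed.

Lemma index_pair_inj i j :
  (0 < i)%N -> (0 < j)%N -> index_pair i = index_pair j -> i = j.
Proof.
move=> i0 j0 e; apply/eqP; rewrite eqn_leq.
rewrite -(index_pair_mono i0 j0) -(index_pair_mono j0 i0) e.
by rewrite /deglex_le eqxx leqnn orbT.
Qed.

(** The N-th pair is (n - m, m), and the pairs below it for [deglex_le] are exactly those of the
    staircase. *)
Lemma staircase_index N n m k : associated N n m -> (0 < k)%N ->
  staircase n m (index_pair k).1 (index_pair k).2 = (k <= N)%N.
Proof.
move=> [/andP[lN Nu] em] k0.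
have mn : (m <= n)%N by rewrite half_triangleS in Nu; lia.
have EN : N = ((n * n.+1)./2 + m).+1 by lia.
have N0 : (0 < N)%N by lia.
rewrite -(index_pair_mono k0 N0).
by rewrite EN index_pair_triangle // /deglex_le /staircase /=; lia.
Qed.

Section Field.

Variable C : fieldType.
Implicit Types (eta theta u : nat -> C) (P Q : {mpoly C[2]}).

(** * Evaluation and univariate Lagrange factors *)

Lemma evalpD P Q x : evalp (P + Q) x = evalp P x + evalp Q x.
Proof. exact: mevalD. Qed.

Lemma evalpB P Q x : evalp (P - Q) x = evalp P x - evalp Q x.
Proof. exact: mevalB. Qed.

Lemma evalpM P Q x : evalp (P * Q) x = evalp P x * evalp Q x.
Proof. exact: mevalM. Qed.

Lemma evalpZ c P x : evalp (c *: P) x = c * evalp P x.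
Proof. exact: mevalZ. Qed.

Lemma evalp_sum (I : Type) (r : seq I) (A : pred I) (F : I -> {mpoly C[2]}) x :
  evalp (\sum_(i <- r | A i) F i) x = \sum_(i <- r | A i) evalp (F i) x.
Proof. exact: raddf_sum. Qed.

(** Common source of [Efac] and [Ffac], which are its images under substitution of a variable;
    values and degrees are thus treated once, in one variable. *)
Definition lagrange1 u (p a : nat) : {poly C} :=
  \prod_(0 <= j < a.+1 | j != p) ((u p - u j)^-1 *: ('X - (u j)%:P)).

Lemma lagrange1_node u p a : injective u -> (lagrange1 u p a).[u p] = 1.
Proof.
move=> u_inj; rewrite /lagrange1 horner_prod big1 // => j jp.
by rewrite !hornerE mulVf // subr_eq0 (inj_eq u_inj) eq_sym.
Qed.

Lemma lagrange1_node_ne u p a s :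
  s != p -> (s <= a)%N -> (lagrange1 u p a).[u s] = 0.
Proof.
move=> sp sa; rewrite /lagrange1 horner_prod.
rewrite big_mkcond (bigD1_seq s) ?iota_uniq ?mem_index_iota //= sp.
by rewrite !hornerE subrr mulr0 mul0r.
Qed.

Lemma lagrange1_eval u p a s : injective u -> (s <= a)%N ->
  (lagrange1 u p a).[u s] = (s == p)%:R.
Proof.
move=> u_inj sa; have [->|sp] := eqVneq s p; first exact: lagrange1_node.
exact: lagrange1_node_ne.
Qed.

Lemma size_lagrange1 u p a : (p <= a)%N -> (size (lagrange1 u p a) <= a.+1)%N.
Proof.
rewrite -ltnS /lagrange1; move: (a.+1) => k pk.
(* The induction on k passes through products with k <= p, where no factor is skipped; the term (p <
   k) records whether one is. *)
suff : (size (\prod_(0 <= j < k | j != p)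
                ((u p - u j)^-1 *: ('X - (u j)%:P)))%R <= k.+1 - (p < k))%N.
  by rewrite pk subn1.
elim: k {pk} => [|k IH]; first by rewrite big_geq // size_poly1.
rewrite big_mkcond big_nat_recr //= -big_mkcond /=.
case: eqVneq => [kp|kp] /=.
  by rewrite mulr1; apply: leq_trans IH _; rewrite kp ltnn ltnSn subn0 subn1.
apply: leq_trans (size_polyMleq _ _) _.
have : (size ((u p - u k)^-1 *: ('X - (u k)%:P)) <= 2)%N.
  by rewrite (leq_trans (size_scale_leq _ _)) ?size_XsubC.
move: IH; set A := size _; set B := size _; move: A B => A B.
by case: (ltnP p k) => pk; case: (ltnP p k.+1) => pk1;
  rewrite /= ?subn0 ?subn1; lia.
Qed.

Lemma horner_algZ (V : {mpoly C[2]}) c (r : {poly C}) :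
  horner_alg V (c *: r) = c *: horner_alg V r.
Proof. by rewrite -mul_polyC rmorphM /= horner_algC mulr_algl. Qed.

Lemma Efac_horner eta p a :
  Efac eta p a = horner_alg (varZ C) (lagrange1 eta p a).
Proof.
rewrite /Efac /lagrange1 rmorph_prod; apply: eq_bigr => j _.
rewrite /= horner_algZ rmorphB /= horner_algX horner_algC.
by rewrite -[(eta j)%:A]mul_mpolyC mulr1.
Qed.

Lemma Ffac_horner theta q b :
  Ffac theta q b = horner_alg (varW C) (lagrange1 theta q b).
Proof.
rewrite /Ffac /lagrange1 rmorph_prod; apply: eq_bigr => j _.
rewrite /= horner_algZ rmorphB /= horner_algX horner_algC.
by rewrite -[(theta j)%:A]mul_mpolyC mulr1.
Qed.


Lemma evalp_horner_alg (V : {mpoly C[2]}) (r : {poly C}) x :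
  evalp (horner_alg V r) x = r.[evalp V x].
Proof.
rewrite -[r]coefK poly_def linear_sum evalp_sum horner_sum.
apply: eq_bigr => i _.
rewrite /= horner_algZ evalpZ hornerZ hornerXn rmorphXn /= horner_algX.
by congr (_ * _); exact: rmorphXn.
Qed.

Lemma evalp_Efac eta p a x : evalp (Efac eta p a) x = (lagrange1 eta p a).[x.1].
Proof. by rewrite Efac_horner evalp_horner_alg /evalp mevalXU. Qed.

Lemma evalp_Ffac theta q b x :
  evalp (Ffac theta q b) x = (lagrange1 theta q b).[x.2].
Proof. by rewrite Ffac_horner evalp_horner_alg /evalp mevalXU. Qed.

(** The factor of index p is skipped, so the larger bound adds nothing; for p = 0 the truncated
    bound is already 0. *)
Lemma Efac_pred eta p : Efac eta p (p - 1) = Efac eta p p.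
Proof.
case: p => [//|p]; rewrite subn1 /Efac [RHS]big_mkcond big_nat_recr //=.
by rewrite eqxx mulr1 -big_mkcond.
Qed.

Lemma Ffac_pred theta q : Ffac theta q (q - 1) = Ffac theta q q.
Proof.
case: q => [//|q]; rewrite subn1 /Ffac [RHS]big_mkcond big_nat_recr //=.
by rewrite eqxx mulr1 -big_mkcond.
Qed.

(** * The telescoped form and the explicit formulas *)

Definition telescope_basis eta theta (a : nat -> nat) (B p q : nat) :=
  Efac eta p (a q) * Ffac theta q q +
  \sum_(q <= b < B)
    Efac eta p (a b.+1) * (Ffac theta q b.+1 - Ffac theta q b).

(** The staircase enters only through the monotone row ends [a]: [s <= a t] puts (s, t) in it, and
    the last hypothesis bounds column p by B. *)
Lemma evalp_telescope_basis eta theta a B p q s t :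
  injective eta -> injective theta ->
  {homo a : b c / (b <= c)%N >-> (c <= b)%N} ->
  (q <= B)%N -> (s <= a t)%N -> (s == p -> t <= B)%N ->
  evalp (telescope_basis eta theta a B p q) (eta s, theta t) =
    ((s == p) && (t == q))%:R.
Proof.
move=> eta_inj theta_inj a_anti qB sat tB.
rewrite /telescope_basis evalpD evalpM evalp_sum evalp_Efac evalp_Ffac /=.
under eq_bigr => b _ do rewrite evalpM evalpB evalp_Efac !evalp_Ffac /=.
have [sp|sp] /= := eqVneq s p.
  rewrite sp lagrange1_node // mul1r.
  under eq_bigr => b _ do rewrite lagrange1_node // mul1r.
  rewrite telescope_sumr // addrC subrK lagrange1_eval //.
  by apply: tB; apply/eqP.
rewrite big1_seq ?addr0 => [|b].
  (* Leading term: if q <= t, then s <= a t <= a q and E vanishes; if t < q, then F_q^q vanishes at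
     theta_t. *)
  case: (leqP q t) => [qt|tq].
    by rewrite lagrange1_node_ne ?mul0r // (leq_trans sat) // a_anti.
  by rewrite [X in _ * X]lagrange1_eval ?(ltnW tq) // (ltn_eqF tq) mulr0.
(* The summand b belongs to row b + 1. If t <= b, both F-factors have t among their nodes and take
   the same value there. *)
rewrite mem_index_iota => /andP[qb bB]; case: (leqP b.+1 t) => [bt|tb].
  by rewrite lagrange1_node_ne ?mul0r // (leq_trans sat) // a_anti.
by rewrite !(lagrange1_eval (u := theta)) ?subrr ?mulr0 //; lia.
Qed.

Lemma lagrange_basis_telescope eta theta n m p q :
  staircase n m p q ->
  lagrange_basis eta theta n m p q =
    telescope_basis eta theta (row_last n m) (col_last n m p) p q.
Proof.
rewrite /staircase /lagrange_basis /telescope_basis => Dpq.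
case: ifP => [c1|c1].
  have -> : col_last n m p = q by rewrite /col_last; case: ifP; lia.
  have -> : row_last n m q = p by rewrite /row_last; case: ifP; lia.
  by rewrite big_geq // addr0 Efac_pred Ffac_pred.
case: ifP => [/andP[c2 /eqP qm]|c2].
  have -> : col_last n m p = q by rewrite /col_last; case: ifP; lia.
  have -> : row_last n m q = (n - m)%N by rewrite /row_last; case: ifP; lia.
  have -> : (n - m - 1)%N = p by lia.
  by rewrite big_geq // addr0 -qm Ffac_pred.
case: ifP => [c3|c3].
  have -> : col_last n m p = q.+1 by rewrite /col_last; case: ifP; lia.
  have -> : row_last n m q = (p + 1)%N by rewrite /row_last; case: ifP; lia.
  rewrite big_nat1.
  have -> : row_last n m q.+1 = p by rewrite /row_last; case: ifP; lia.
  by rewrite Efac_pred Ffac_pred addn1 (addn1 q) mulrBr addrAC addrA.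
(* In the remaining cases the summand b = q joins the leading term to form the three-term head, and
   r = b - q indexes the rest. *)
have step B (G : nat -> {mpoly C[2]}) : (q < B)%N ->
    \sum_(q <= b < B) G b = G q + \sum_(1 <= r < B - q) G (q + r)%N.
  move=> qB; rewrite -{1}[q]add0n big_addn big_ltn ?subn_gt0 // add0n.
  by congr (_ + _); apply: eq_bigr => r _; rewrite addnC.
case: ifP => [c4|c4].
  have -> : col_last n m p = (n - p - 1)%N by rewrite /col_last; case: ifP; lia.
  rewrite step; last lia.
  (* Row q + r + 1 exceeds m from r = m - q on, where [row_last] changes branch; hence the two
     sums. *)
  rewrite [in RHS](@big_cat_nat _ _ _ (m - q)%N) /=; [|lia|lia].
  rewrite !addrA Ffac_pred.
  have -> : row_last n m q = (n - q)%N by rewrite /row_last; case: ifP; lia.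
  have -> : row_last n m q.+1 = (n - q - 1)%N
    by rewrite /row_last; case: ifP; lia.
  rewrite mulrBr addn1.
  have -> : (n - p - 1 - q = n - p - q - 1)%N by lia.
  congr (_ + _ + _); first by rewrite addrA addrAC.
    apply: eq_big_nat => r r_lt; rewrite mulrBr addn1.
    by have -> : row_last n m (q + r).+1 = (n - q - r - 1)%N
      by rewrite /row_last; case: ifP; lia.
  apply: eq_big_nat => r r_lt; rewrite mulrBr addn1.
  by have -> : row_last n m (q + r).+1 = (n - q - r - 2)%N
    by rewrite /row_last; case: ifP; lia.
case: ifP => [c5|c5].
  (* Here B = n - p <= m, so all rows involved are on the first branch of [row_last]. *)
  have -> : col_last n m p = (n - p)%N by rewrite /col_last; case: ifP; lia.
  rewrite step; last lia.
  rewrite !addrA Ffac_pred.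
  have -> : row_last n m q = (n - q)%N by rewrite /row_last; case: ifP; lia.
  have -> : row_last n m q.+1 = (n - q - 1)%N
    by rewrite /row_last; case: ifP; lia.
  rewrite mulrBr addn1.
  congr (_ + _); first by rewrite addrA addrAC.
  apply: eq_big_nat => r r_lt; rewrite mulrBr addn1.
  by have -> : row_last n m (q + r).+1 = (n - q - r - 1)%N
    by rewrite /row_last; case: ifP; lia.
case: ifP => [/andP[c6 /eqP qm]|c6].
  (* Row m is the last one on the first branch, so the row end drops by two from row m to row m +
     1. *)
  have -> : col_last n m p = (n - p - 1)%N by rewrite /col_last; case: ifP; lia.
  rewrite step; last lia.
  rewrite !addrA -qm Ffac_pred.
  have -> : row_last n q q = (n - q)%N by rewrite /row_last; case: ifP; lia.
  have -> : row_last n q q.+1 = (n - q - 2)%N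
    by rewrite /row_last; case: ifP; lia.
  rewrite mulrBr addn1.
  have -> : (n - p - 1 - q = n - q - p - 1)%N by lia.
  congr (_ + _); first by rewrite addrA addrAC.
  apply: eq_big_nat => r r_lt; rewrite mulrBr addn1.
  by have -> : row_last n q (q + r).+1 = (n - q - r - 2)%N
    by rewrite /row_last; case: ifP; lia.
(* Membership in the staircase leaves only the seventh case; the default 0 is never reached. *)
have -> : (p + q + 2 <= n)%N && (m + 1 <= q)%N by lia.
have -> : col_last n m p = (n - p - 1)%N by rewrite /col_last; case: ifP; lia.
rewrite step; last lia.
rewrite !addrA Ffac_pred.
have -> : row_last n m q = (n - q - 1)%N by rewrite /row_last; case: ifP; lia.
have -> : row_last n m q.+1 = (n - q - 2)%N
  by rewrite /row_last; case: ifP; lia.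
rewrite mulrBr addn1.
have -> : (n - p - 1 - q = n - p - q - 1)%N by lia.
congr (_ + _); first by rewrite addrA addrAC.
apply: eq_big_nat => r r_lt; rewrite mulrBr addn1.
by have -> : row_last n m (q + r).+1 = (n - q - r - 2)%N
  by rewrite /row_last; case: ifP; lia.
Qed.

(** * Membership in the polynomial space *)

Lemma horner_alg_wide (V : {mpoly C[2]}) (r : {poly C}) d :
  (size r <= d)%N -> horner_alg V r = \sum_(i < d) r`_i *: V ^+ i.
Proof.
move=> rd; have -> : horner_alg V r = horner_alg V (\poly_(i < d) r`_i).
  congr (horner_alg V _); apply/polyP => i; rewrite coef_poly.
  by case: ltnP => // di; rewrite nth_default // (leq_trans rd).
rewrite poly_def linear_sum; apply: eq_bigr => i _.
by rewrite /= horner_algZ rmorphXn /= horner_algX.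
Qed.

Lemma inPspace0 N : inPspace N (0 : {mpoly C[2]}).
Proof. by exists (fun=> 0); rewrite big1 // => j _; rewrite scale0r. Qed.

Lemma inPspaceD N P Q : inPspace N P -> inPspace N Q -> inPspace N (P + Q).
Proof.
case=> c -> [d ->]; exists (fun j => c j + d j).
by rewrite -big_split; apply: eq_bigr => j _; rewrite scalerDl.
Qed.

Lemma inPspaceZ N k P : inPspace N P -> inPspace N (k *: P).
Proof.
case=> c ->; exists (fun j => k * c j).
by rewrite scaler_sumr; apply: eq_bigr => j _; rewrite scalerA.
Qed.

Lemma inPspaceB N P Q : inPspace N P -> inPspace N Q -> inPspace N (P - Q).
Proof. by move=> NP NQ; rewrite -scaleN1r; apply/inPspaceD/inPspaceZ. Qed.

Lemma inPspace_sum N (I : eqType) (r : seq I) (F : I -> {mpoly C[2]}) :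
  (forall i, i \in r -> inPspace N (F i)) -> inPspace N (\sum_(i <- r) F i).
Proof.
move=> NF; rewrite big_seq.
exact: (big_ind (inPspace N) (inPspace0 N) (@inPspaceD N)).
Qed.

Lemma inPspace_monom N j : (0 < j <= N)%N -> inPspace N (monom C j).
Proof.
move=> jN; exists (fun k => (k == j)%:R).
rewrite (bigD1_seq j) ?iota_uniq ?mem_index_iota ?ltnS //=.
rewrite eqxx scale1r big1 ?addr0 // => k /negbTE ->.
by rewrite scale0r.
Qed.

Lemma inPspace_staircase N n m i j : associated N n m -> staircase n m i j ->
  inPspace N (varZ C ^+ i * varW C ^+ j).
Proof.
move=> nm; have [k k0 ek] := index_pair_surj (i, j) => Dij.
have := inPspace_monom (N := N) (j := k); rewrite /monom ek; apply.
by rewrite k0 -(staircase_index nm k0) ek.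
Qed.

(** Since p <= a and q <= b, one factor is skipped in each product, so the degrees are at most a and
    b and the monomials fill at most the given rectangle. *)
Lemma inPspace_mul eta theta N n m p q a b : associated N n m ->
  (p <= a)%N -> (q <= b)%N ->
  (forall i j, (i <= a)%N -> (j <= b)%N -> staircase n m i j) ->
  inPspace N (Efac eta p a * Ffac theta q b).
Proof.
move=> nm pa qb D; rewrite Efac_horner Ffac_horner.
rewrite (horner_alg_wide _ (size_lagrange1 eta pa)).
rewrite (horner_alg_wide _ (size_lagrange1 theta qb)).
rewrite mulr_suml; apply: inPspace_sum => i _.
rewrite mulr_sumr; apply: inPspace_sum => j _.
rewrite -scalerAl -scalerAr; do 2!apply: inPspaceZ.
by apply: inPspace_staircase nm (D _ _ _ _); rewrite -ltnS.
Qed.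

Lemma inPspace_lagrange_basis eta theta N n m p q : associated N n m ->
  staircase n m p q -> inPspace N (lagrange_basis eta theta n m p q).
Proof.
move=> nm Dpq; rewrite lagrange_basis_telescope //.
apply: inPspaceD.
  apply: (inPspace_mul _ _ nm) => //; first exact: staircase_row.
  by move=> i j; exact: staircase_row_last Dpq.
apply: inPspace_sum => b; rewrite mem_index_iota => /andP[qb bB].
(* [bB] reads b + 1 <= [col_last n m p], so row b + 1 contains p and its rectangle serves both
   F-factors. *)
have Dpb := staircase_col_last Dpq bB; have pa := staircase_row Dpb.
rewrite mulrBr; apply: inPspaceB; apply: (inPspace_mul _ _ nm) => //.
- exact: leqW.
- by move=> i j; exact: staircase_row_last Dpb.
by move=> i j ia jb; apply: staircase_row_last Dpb ia (leqW jb).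
Qed.

(** * Values at the nodes and existence *)

Lemma evalp_lagrange_basis eta theta n m p q s t :
  injective eta -> injective theta -> staircase n m p q -> staircase n m s t ->
  evalp (lagrange_basis eta theta n m p q) (eta s, theta t) =
    ((s, t) == (p, q))%:R.
Proof.
move=> eta_inj theta_inj Dpq Dst; rewrite lagrange_basis_telescope //.
apply: evalp_telescope_basis => //.
- exact: row_last_anti.
- exact: staircase_col Dpq.
- exact: staircase_row.
- by move/eqP <-; exact: staircase_col Dst.
Qed.

Lemma evalp_lagrange_basis_index eta theta N n m j k :
  injective eta -> injective theta -> associated N n m ->
  (0 < j <= N)%N -> (0 < k <= N)%N ->
  evalp (lagrange_basis eta theta n m (index_pair j).1 (index_pair j).2)
    (intertwining eta theta k) = (k == j)%:R.
Proof.
move=> eta_inj theta_inj nm /andP[j0 jN] /andP[k0 kN].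
rewrite evalp_lagrange_basis ?(staircase_index nm) // -!surjective_pairing.
congr (nat_of_bool _)%:R; apply/eqP/eqP => [|-> //].
exact: index_pair_inj.
Qed.

Lemma inPspace_lagrange_poly eta theta N n m f :
  associated N n m -> inPspace N (lagrange_poly eta theta N n m f).
Proof.
move=> nm; apply: inPspace_sum => k.
rewrite mem_index_iota ltnS => /andP[k0 kN].
by apply/inPspaceZ/inPspace_lagrange_basis; rewrite ?(staircase_index nm).
Qed.

Lemma OmegaP eta theta N x :
  reflect (exists2 k, (0 < k <= N)%N & x = intertwining eta theta k)
    (x \in Omega eta theta N).
Proof.
by apply: (iffP mapP) => -[k]; rewrite ?mem_iota => kN ->; exists k;
  rewrite ?mem_iota // add1n ltnS in kN *.
Qed.

Lemma interpolates_lagrange_poly eta theta N n m f :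
  injective eta -> injective theta -> associated N n m ->
  interpolates (Omega eta theta N) f (lagrange_poly eta theta N n m f).
Proof.
move=> eta_inj theta_inj nm x /OmegaP[k kN ->].
rewrite evalp_sum (bigD1_seq k) ?iota_uniq ?mem_index_iota ?ltnS //=.
rewrite evalpZ (evalp_lagrange_basis_index _ _ nm) // eqxx mulr1.
rewrite big1_seq ?addr0 // => j; rewrite mem_index_iota ltnS => /andP[jk jN].
rewrite evalpZ (evalp_lagrange_basis_index _ _ nm) //.
by rewrite eq_sym (negbTE jk) mulr0.
Qed.

(** * Uniqueness by linear algebra *)

Lemma inPspaceP N P : inPspace N P ->
  exists c : 'rV[C]_N, P = \sum_i c 0 i *: monom C i.+1.
Proof.
case=> c ->; exists (\row_i c i.+1).
by rewrite big_add1 big_mkord; apply: eq_bigr => i _; rewrite mxE.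
Qed.

Lemma inPspace_interpolates0 eta theta N n m P :
  injective eta -> injective theta -> associated N n m -> inPspace N P ->
  interpolates (Omega eta theta N) (fun=> 0) P -> P = 0.
Proof.
move=> eta_inj theta_inj nm /inPspaceP[c ->] P0.
pose H (k : 'I_N) := intertwining eta theta k.+1.
pose M : 'M[C]_N := \matrix_(j, k) evalp (monom C j.+1) (H k).
have value (d : 'rV_N) k :
    evalp (\sum_i d 0 i *: monom C i.+1) (H k) = (d *m M) 0 k.
  by rewrite evalp_sum mxE; apply: eq_bigr => i _; rewrite evalpZ mxE.
have Nl (i : 'I_N) : inPspace N
    (lagrange_basis eta theta n m (index_pair i.+1).1 (index_pair i.+1).2).
  by apply: inPspace_lagrange_basis; rewrite ?(staircase_index nm) ?ltn_ord.
have [L basisE] := fin_all_exists (fun i => inPspaceP (Nl i)).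
(* Row i of the left factor holds the monomial coefficients of the i-th basis polynomial, so the
   product lists the values of the basis at the nodes. *)
have LM : (\matrix_i L i) *m M = 1%:M.
  apply/row_matrixP => i; apply/rowP => k.
  rewrite row_mul rowK -value -basisE.
  rewrite (evalp_lagrange_basis_index _ _ nm) ?ltn_ord //.
  by rewrite !mxE eqSS eq_sym.
have cM : c *m M = 0.
  apply/rowP => k; rewrite -value P0 ?mxE //.
  by apply/OmegaP; exists k.+1 => //; rewrite ltn_ord.
(* Both matrices are square, so the left inverse of [M] is also a right inverse, and c = (c M) L =
   0. *)
rewrite -[c]mulmx1 -(mulmx1C LM) mulmxA cM mul0mx.
by rewrite big1 // => i _; rewrite mxE scale0r.
Qed.

Lemma inPspace_interpolates_eq eta theta N n m f P Q :
  injective eta -> injective theta -> associated N n m ->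
  inPspace N P -> interpolates (Omega eta theta N) f P ->
  inPspace N Q -> interpolates (Omega eta theta N) f Q -> P = Q.
Proof.
move=> eta_inj theta_inj nm NP fP NQ fQ.
apply/eqP; rewrite -subr_eq0; apply/eqP.
apply: (inPspace_interpolates0 eta_inj theta_inj nm (inPspaceB NP NQ)) => x Ax.
by rewrite evalpB fP // fQ // subrr.
Qed.

End Field.

Theorem corollary6 (R : realType) (eta theta : nat -> R[i])
    (eta_inj : injective eta) (theta_inj : injective theta)
    (N n m : nat) (N_ge1 : (1 <= N)%N) (nm_assoc : associated N n m) :
  unisolvent (Omega eta theta N) (inPspace N) /\
  (forall (f : R[i] * R[i] -> R[i]) (P : {mpoly R[i][2]}),
     inPspace N P -> interpolates (Omega eta theta N) f P ->
     P = lagrange_poly eta theta N n m f).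
Proof.
have NL f := inPspace_lagrange_poly eta theta f nm_assoc.
have fL f := interpolates_lagrange_poly f eta_inj theta_inj nm_assoc.
have uniq f := inPspace_interpolates_eq (f := f) eta_inj theta_inj nm_assoc.
split=> [f|f P NP fP]; last exact: uniq NP fP (NL f) (fL f).
exists (lagrange_poly eta theta N n m f); split=> // Q [NQ fQ].
exact: uniq (NL f) (fL f) NQ fQ.
Qed.
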